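(* The category $\mathbf{Skb}$ of skew braces is not action representable. That is, it is not true that for every skew brace $X$ there exist a skew brace $T(X)$ and a natural isomorphism of functors $\mathbf{Skb}^{\mathrm{op}}\to\mathbf{Set}$ $$\mathrm{Split}(-,X)\;\cong\;\mathbf{Skb}(-,T(X)).$$
   Context: A skew (left) brace is a set $B$ with two group operations $+$ and $\circ$ (neither assumed commutative) such that $a\circ(b+c)=a\circ b-a+a\circ c$ for all $a,b,c\in B$. The identities of $(B,+)$ and $(B,\circ)$ coincide and are denoted $0$. $\mathbf{Skb}$ is the category whose objects are skew braces and whose morphisms are maps preserving both operations; $\mathbf{Skb}(A,B)$ denotes the set of morphisms $A\to B$. It is a semi-abelian variety with zero object $\{0\}$. For skew braces $A,X$, a split extension of $A$ by $X$ is a quadruple $(E,p,s,\mu)$ where $E$ is a skew brace and $\mu:X\to E$, $p:E\to A$, $s:A\to E$ are morphisms such that $\mu$ is a kernel of $p$ (injective with image $\{e\in E:p(e)=0\}$) and $ps=\mathrm{id}_A$. Two split extensions $(E,p,s,\mu)$ and $(E',p',s',\mu')$ of $A$ by $X$ are isomorphic if there is a morphism (necessarily an isomorphism) $f:E\to E'$ with $f\mu=\mu'$, $p'f=p$, $fs=s'$. $\mathrm{Split}(A,X)$ is the set of isomorphism classes of split extensions of $A$ by $X$. For fixed $X$, $\mathrm{Split}(-,X):\mathbf{Skb}^{\mathrm{op}}\to\mathbf{Set}$ is a functor: for a morphism $f:A'\to A$, the class of $(E,p,s,\mu)$ is sent to the class of $(E',p',s',\mu')$, where $E'$ is the pullback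 of $p$ along $f$ with projections $p':E'\to A'$ and $g:E'\to E$, and $s',\mu'$ are the unique morphisms with $p'\mu'=0$, $g\mu'=\mu$, $p's'=\mathrm{id}_{A'}$, $gs'=sf$. *)

(* Defs.v *)
From Corelib Require Import ssreflect ssrfun.
From Stdlib Require Import FunctionalExtensionality PropExtensionality.
From Stdlib Require Import ProofIrrelevance IndefiniteDescription.

Set Implicit Arguments.
Unset Strict Implicit.
Unset Printing Implicit Defensive.
#[local] Obligation Tactic := idtac.

Record is_group (T : Type) (op : T -> T -> T) (e : T) (inv : T -> T) : Prop := {
  group_assoc : forall x y z, op x (op y z) = op (op x y) z;
  group_idl : forall x, op e x = x;
  group_idr : forall x, op x e = x;
  group_invl : forall x, op (inv x) x = e;
  group_invr : forall x, op x (inv x) = e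
}.

(* The neutral elements of the two groups are separate fields; they are equal
   by [zero_one] below. *)
Record SkewBrace := {
  carrier :> Type;
  add : carrier -> carrier -> carrier;
  zero : carrier;
  opp : carrier -> carrier;
  circ : carrier -> carrier -> carrier;
  one : carrier;
  inv : carrier -> carrier;
  add_group : is_group add zero opp;
  circ_group : is_group circ one inv;
  brace_compat : forall a b c : carrier,
    circ a (add b c) = add (add (circ a b) (opp a)) (circ a c)
}.

Arguments zero {_}.
Arguments one {_}.

Declare Scope brace_scope.
Delimit Scope brace_scope with brace.
Local Open Scope brace_scope.
Local Notation "0" := zero : brace_scope.
Local Notation "x + y" := (add x y) : brace_scope.
Local Notation "- x" := (opp x) : brace_scope.
Local Notation "x - y" := (add x (opp y)) : brace_scope.
Local Notation "x ∘ y" := (circ x y) (at level 40, left associativity) : brace_scope.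

Section BraceTheory.
Variable B : SkewBrace.
Implicit Types a b c : B.

Lemma addA a b c : a + (b + c) = a + b + c.
Proof. exact: (group_assoc (add_group B)). Qed.
Lemma add0 a : 0 + a = a. Proof. exact: (group_idl (add_group B)). Qed.
Lemma addr0 a : a + 0 = a. Proof. exact: (group_idr (add_group B)). Qed.
Lemma addN a : - a + a = 0. Proof. exact: (group_invl (add_group B)). Qed.
Lemma addrN a : a - a = 0. Proof. exact: (group_invr (add_group B)). Qed.
Lemma add_cancel a b c : a + b = a + c -> b = c.
Proof. by move=> H; rewrite -(add0 b) -(add0 c) -(addN a) -!addA H. Qed.
Lemma add_cancelr a b c : b + a = c + a -> b = c.
Proof. by move=> H; rewrite -(addr0 b) -(addr0 c) -(addrN a) !addA H. Qed.

Lemma zero_one : zero = one :> B.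
Proof.
have H := brace_compat one (zero : B) zero.
rewrite !(group_idl (circ_group B)) !addr0 add0 in H.
by apply: (@add_cancel (- one)); rewrite addN addr0 -H.
Qed.

Lemma circ00 : 0 ∘ 0 = 0 :> B.
Proof. by rewrite {1}zero_one (group_idl (circ_group B)). Qed.
End BraceTheory.

Record Hom (A B : SkewBrace) := {
  hom_fun :> A -> B;
  hom_add : forall x y, hom_fun (x + y) = hom_fun x + hom_fun y;
  hom_circ : forall x y, hom_fun (x ∘ y) = hom_fun x ∘ hom_fun y
}.

Lemma hom_eq (A B : SkewBrace) (f g : Hom A B) : (forall x, f x = g x) -> f = g.
Proof.
case: f g => [f fa fc] [g ga gc] /= /functional_extensionality fg.
subst g; f_equal; exact: proof_irrelevance.
Qed.

Lemma hom_zero (A B : SkewBrace) (f : Hom A B) : f 0 = 0.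
Proof. by apply: (@add_cancel _ (f 0)); rewrite -hom_add !addr0. Qed.

Lemma hom_opp (A B : SkewBrace) (f : Hom A B) x : f (- x) = - f x.
Proof. by apply: (@add_cancel _ (f x)); rewrite -hom_add !addrN hom_zero. Qed.

Lemma hom_one (A B : SkewBrace) (f : Hom A B) : f one = one.
Proof. by rewrite -!zero_one hom_zero. Qed.

Lemma hom_inv (A B : SkewBrace) (f : Hom A B) x : f (inv x) = inv (f x).
Proof.
have gB := circ_group B.
rewrite -[LHS](group_idl gB) -(group_invl gB (f x)) -(group_assoc gB).
by rewrite -hom_circ (group_invr (circ_group A)) hom_one (group_idr gB).
Qed.

Definition hom_id (A : SkewBrace) : Hom A A :=
  {| hom_fun := fun x => x;
     hom_add := fun _ _ => erefl;
     hom_circ := fun _ _ => erefl |}.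

Program Definition hom_comp (A B C : SkewBrace) (g : Hom B C) (f : Hom A B) :
  Hom A C := {| hom_fun := fun x => g (f x) |}.
Next Obligation. by move=> A B C g f x y /=; rewrite !hom_add. Qed.
Next Obligation. by move=> A B C g f x y /=; rewrite !hom_circ. Qed.

Record SplitExt (A X : SkewBrace) := {
  ext : SkewBrace;
  ext_p : Hom ext A;
  ext_s : Hom A ext;
  ext_mu : Hom X ext;
  ext_mu_inj : forall x y, ext_mu x = ext_mu y -> x = y;
  ext_mu_ker : forall e, ext_p e = 0 <-> exists x, ext_mu x = e;
  ext_ps : forall a, ext_p (ext_s a) = a
}.

Definition split_iso (A X : SkewBrace) (E E' : SplitExt A X) : Prop :=
  exists f : Hom (ext E) (ext E'),
    (forall x, f (ext_mu E x) = ext_mu E' x) /\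
    (forall e, ext_p E' (f e) = ext_p E e) /\
    (forall a, f (ext_s E a) = ext_s E' a).

Section Pullback.
Variables (A A' X : SkewBrace) (f : Hom A' A) (E : SplitExt A X).

Definition pb_carrier : Type :=
  { w : A' * ext E | f (fst w) = ext_p E (snd w) }.

Lemma pb_eq (u v : pb_carrier) :
  fst (sval u) = fst (sval v) -> snd (sval u) = snd (sval v) -> u = v.
Proof.
case: u v => [[a e] h] [[a' e'] h'] /= ea ee; subst a' e'.
by rewrite (proof_irrelevance _ h h').
Qed.

Program Definition pb_add (u v : pb_carrier) : pb_carrier :=
  exist _ (fst (sval u) + fst (sval v), snd (sval u) + snd (sval v)) _.
Next Obligation. by move=> [u hu] [v hv] /=; rewrite !hom_add hu hv. Qed.
Program Definition pb_circ (u v : pb_carrier) : pb_carrier :=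
  exist _ (fst (sval u) ∘ fst (sval v), snd (sval u) ∘ snd (sval v)) _.
Next Obligation. by move=> [u hu] [v hv] /=; rewrite !hom_circ hu hv. Qed.
Program Definition pb_zero : pb_carrier := exist _ (0, 0) _.
Next Obligation. by rewrite /= !hom_zero. Qed.
Program Definition pb_one : pb_carrier := exist _ (one, one) _.
Next Obligation. by rewrite /= !hom_one. Qed.
Program Definition pb_opp (u : pb_carrier) : pb_carrier :=
  exist _ (- fst (sval u), - snd (sval u)) _.
Next Obligation. by move=> [u hu] /=; rewrite !hom_opp hu. Qed.
Program Definition pb_inv (u : pb_carrier) : pb_carrier :=
  exist _ (inv (fst (sval u)), inv (snd (sval u))) _.
Next Obligation. by move=> [u hu] /=; rewrite !hom_inv hu. Qed.

Lemma pb_add_group : is_group pb_add pb_zero pb_opp.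
Proof.
split=> *; apply: pb_eq => /=;
  by rewrite ?addA ?add0 ?addr0 ?addN ?addrN.
Qed.

Lemma pb_circ_group : is_group pb_circ pb_one pb_inv.
Proof.
have gA := circ_group A'; have gE := circ_group (ext E).
split=> *; apply: pb_eq => /=;
  first [exact: (group_assoc gA) | exact: (group_assoc gE)
        | exact: (group_idl gA) | exact: (group_idl gE)
        | exact: (group_idr gA) | exact: (group_idr gE)
        | exact: (group_invl gA) | exact: (group_invl gE)
        | exact: (group_invr gA) | exact: (group_invr gE)].
Qed.

Lemma pb_compat a b c :
  pb_circ a (pb_add b c) = pb_add (pb_add (pb_circ a b) (pb_opp a)) (pb_circ a c).
Proof. by apply: pb_eq => /=; rewrite brace_compat. Qed.

Definition pb : SkewBrace :=
  {| carrier := pb_carrier;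
     add_group := pb_add_group;
     circ_group := pb_circ_group;
     brace_compat := pb_compat |}.

Definition pb_p : Hom pb A' :=
  {| hom_fun := fun w : pb => fst (sval w);
     hom_add := fun _ _ => erefl;
     hom_circ := fun _ _ => erefl |}.

Definition pb_g : Hom pb (ext E) :=
  {| hom_fun := fun w : pb => snd (sval w);
     hom_add := fun _ _ => erefl;
     hom_circ := fun _ _ => erefl |}.

Program Definition pb_s : Hom A' pb :=
  {| hom_fun := fun a => exist _ (a, ext_s E (f a)) _ |}.
Next Obligation. by move=> a /=; rewrite ext_ps. Qed.
Next Obligation. by move=> x y; apply: pb_eq => //=; rewrite !hom_add. Qed.
Next Obligation. by move=> x y; apply: pb_eq => //=; rewrite !hom_circ. Qed.

Program Definition pb_mu : Hom X pb :=
  {| hom_fun := fun x => exist _ (0, ext_mu E x) _ |}.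
Next Obligation.
by move=> x /=; rewrite hom_zero; symmetry; apply/ext_mu_ker; exists x.
Qed.
Next Obligation. by move=> x y; apply: pb_eq => /=; rewrite ?hom_add ?add0. Qed.
Next Obligation.
by move=> x y; apply: pb_eq => /=; rewrite ?hom_circ ?circ00.
Qed.

Program Definition pullback : SplitExt A' X :=
  {| ext := pb; ext_p := pb_p; ext_s := pb_s; ext_mu := pb_mu |}.
Next Obligation.
by move=> x y /(f_equal (fun w => snd (sval w))) /= /ext_mu_inj.
Qed.
Next Obligation.
move=> [[a e] h] /=; split=> [a0 | [x /(f_equal (fun w => fst (sval w))) /= <-]] //.
have /ext_mu_ker [x ex] : ext_p E e = 0 by rewrite -h /= a0 hom_zero.
by exists x; apply: pb_eq.
Qed.
Next Obligation. by []. Qed.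

Lemma pb_s_unique (s' : Hom A' pb) :
  (forall a, pb_p (s' a) = a) -> (forall a, pb_g (s' a) = ext_s E (f a)) ->
  s' = pb_s.
Proof. by move=> h1 h2; apply: hom_eq => a; apply: pb_eq; [exact: h1 | exact: h2]. Qed.

Lemma pb_mu_unique (m : Hom X pb) :
  (forall x, pb_p (m x) = 0) -> (forall x, pb_g (m x) = ext_mu E x) ->
  m = pb_mu.
Proof. by move=> h1 h2; apply: hom_eq => x; apply: pb_eq; [exact: h1 | exact: h2]. Qed.

Lemma pullback_univ (E1 : SplitExt A' X) (h : Hom (ext E1) (ext E)) :
  (forall x, h (ext_mu E1 x) = ext_mu E x) ->
  (forall e, ext_p E (h e) = f (ext_p E1 e)) ->
  (forall a, h (ext_s E1 a) = ext_s E (f a)) ->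
  split_iso E1 pullback.
Proof.
move=> hmu hp hs.
pose k (e : ext E1) : pb := exist _ (ext_p E1 e, h e) (esym (hp e)).
have ka x y : k (x + y) = k x + k y by apply: pb_eq; rewrite /= hom_add.
have kc x y : k (x ∘ y) = k x ∘ k y by apply: pb_eq; rewrite /= hom_circ.
exists {| hom_fun := k; hom_add := ka; hom_circ := kc |}; split; [|split] => //=.
- move=> x; apply: pb_eq => //=.
  by apply/ext_mu_ker; exists x.
- by move=> a; apply: pb_eq; rewrite /= ?ext_ps ?hs.
Qed.
End Pullback.

Section SplitIso.
Variables A X : SkewBrace.
Implicit Types E F G : SplitExt A X.

Lemma split_iso_refl E : split_iso E E.
Proof. by exists (hom_id (ext E)). Qed.

Lemma split_iso_trans E F G : split_iso E F -> split_iso F G -> split_iso E G.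
Proof.
move=> [f [fm [fp fs]]] [g [gm [gp gs]]]; exists (hom_comp g f).
by split; [|split] => z /=; rewrite ?fm ?gm ?gp ?fp ?fs ?gs.
Qed.

Lemma ext_decomp E (e : ext E) :
  exists x, e = ext_mu E x + ext_s E (ext_p E e).
Proof.
have : ext_p E (e - ext_s E (ext_p E e)) = 0.
  by rewrite hom_add hom_opp ext_ps addrN.
by move=> /ext_mu_ker [x ex]; exists x; rewrite ex -addA addN addr0.
Qed.

(* The split short five lemma: every morphism as in [split_iso] is invertible. *)
Lemma split_iso_sym E F : split_iso E F -> split_iso F E.
Proof.
move=> [f [fm [fp fs]]].
have finj e e' : f e = f e' -> e = e'.
  move=> h; have hp : ext_p E e = ext_p E e' by rewrite -!fp h.
  case: (ext_decomp e) (ext_decomp e') => [x ex] [y ey].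
  move: h; rewrite ex ey !hom_add !fm !fs hp.
  by move=> /add_cancelr /ext_mu_inj ->.
have fsurj e : exists d, f d = e.
  case: (ext_decomp e) => x ex; exists (ext_mu E x + ext_s E (ext_p F e)).
  by rewrite hom_add fm fs -ex.
pose g e := sval (constructive_indefinite_description _ (fsurj e)).
have fg e : f (g e) = e by exact: (svalP (constructive_indefinite_description _ (fsurj e))).
have ga x y : g (x + y) = g x + g y by apply: finj; rewrite hom_add !fg.
have gc x y : g (x ∘ y) = g x ∘ g y by apply: finj; rewrite hom_circ !fg.
exists {| hom_fun := g; hom_add := ga; hom_circ := gc |}; split; [|split] => /= z.
- by apply: finj; rewrite fg fm.
- by rewrite -{2}(fg z) fp.
- by apply: finj; rewrite fg fs.
Qed.

Definition split_class E : SplitExt A X -> Prop := fun F => split_iso E F.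

(* An isomorphism class is represented by the predicate of its members. *)
Definition SplitClass : Type :=
  { C : SplitExt A X -> Prop | exists E, C = split_class E }.

Definition class_of E : SplitClass :=
  exist _ (split_class E) (ex_intro _ E erefl).

Lemma class_eq (C D : SplitClass) : (forall E, sval C E <-> sval D E) -> C = D.
Proof.
case: C D => [C hC] [D hD] /= h.
have eCD : C = D.
  by apply: functional_extensionality => E; apply: propositional_extensionality.
by subst D; rewrite (proof_irrelevance _ hC hD).
Qed.

Lemma class_ofP E F : class_of E = class_of F <-> split_iso E F.
Proof.
split=> [h | h].
- have : sval (class_of F) F by exact: split_iso_refl.
  by rewrite -h.
- apply: class_eq => G; split=> /= hG.
  + exact: split_iso_trans (split_iso_sym h) hG.
  + exact: split_iso_trans h hG.
Qed.

Lemma class_of_surj (C : SplitClass) : exists E, C = class_of E.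
Proof.
case: C => [C hC]; case: (hC) => E eC; exists E.
by apply: class_eq => G; rewrite /= eC.
Qed.
End SplitIso.

Lemma pullback_iso (A A' X : SkewBrace) (f : Hom A' A) (E F : SplitExt A X) :
  split_iso E F -> split_iso (pullback f E) (pullback f F).
Proof.
move=> [k [km [kp ks]]].
apply: (@pullback_univ _ _ _ f F (pullback f E) (hom_comp k (pb_g f E))) => z /=.
- exact: km.
- by rewrite kp -(svalP z).
- exact: ks.
Qed.

(* Since an isomorphism class is a predicate, the class of the pullback is
   described without choosing a representative: it consists of the extensions
   isomorphic to the pullback of some member (see [split_map_class]). *)
Program Definition split_map (A A' X : SkewBrace) (f : Hom A' A)
    (C : SplitClass A X) : SplitClass A' X :=
  exist _ (fun E' => exists E, sval C E /\ split_iso (pullback f E) E') _.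
Next Obligation.
move=> A A' X f C; case: (class_of_surj C) => E -> /=; exists (pullback f E).
apply: functional_extensionality => G; apply: propositional_extensionality.
split=> [[F [EF FG]] | EG].
- exact: split_iso_trans (pullback_iso f EF) FG.
- by exists E; split=> //; exact: split_iso_refl.
Qed.

Lemma split_map_class (A A' X : SkewBrace) (f : Hom A' A) (E : SplitExt A X) :
  split_map f (class_of E) = class_of (pullback f E).
Proof.
apply: class_eq => G /=; split=> [[F [EF FG]] | EG].
- exact: split_iso_trans (pullback_iso f EF) FG.
- by exists E; split=> //; exact: split_iso_refl.
Qed.

(* Functors from the opposite of the category of skew braces to sets. *)
Record Presheaf := {
  psh_obj :> SkewBrace -> Type;
  psh_map : forall A A' : SkewBrace, Hom A' A -> psh_obj A -> psh_obj A';
  psh_map_id : forall A (x : psh_obj A), psh_map (hom_id A) x = x;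
  psh_map_comp : forall A A' A'' (f : Hom A' A) (g : Hom A'' A') (x : psh_obj A),
    psh_map (hom_comp f g) x = psh_map g (psh_map f x)
}.

Definition nat_isomorphic (F G : Presheaf) : Prop :=
  exists eta : forall A, F A -> G A,
    (forall A A' (f : Hom A' A) (x : F A),
       eta A' (psh_map f x) = psh_map f (eta A x)) /\
    (forall A, bijective (eta A)).

Program Definition Split (X : SkewBrace) : Presheaf :=
  {| psh_obj := fun A => SplitClass A X;
     psh_map := fun A A' f C => split_map f C |}.
Next Obligation.
move=> X A C; case: (class_of_surj C) => E ->; rewrite split_map_class.
apply/class_ofP; apply: split_iso_sym.
by apply: (@pullback_univ _ _ _ (hom_id A) E E (hom_id (ext E))).
Qed.
Next Obligation.
move=> X A A' A'' f g C; case: (class_of_surj C) => E ->; rewrite !split_map_class.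
apply/class_ofP; apply: split_iso_sym.
apply: (@pullback_univ _ _ _ (hom_comp f g) E (pullback g (pullback f E))
  (hom_comp (pb_g f E) (pb_g g (pullback f E)))) => //= z.
by rewrite -(svalP (snd (sval z))) /= (svalP z).
Qed.

Program Definition Representable (T : SkewBrace) : Presheaf :=
  {| psh_obj := fun A => Hom A T;
     psh_map := fun A A' f h => hom_comp h f |}.
Next Obligation. by move=> T A h; apply: hom_eq. Qed.
Next Obligation. by move=> T A A' A'' f g h; apply: hom_eq. Qed.

(* Main.v *)
(** If [Split(-, X)] is represented by [T], a split extension of [A] by [X]
    corresponds to a morphism [h : A -> T], and the pullback of the extension
    along [f] is trivial exactly when [h f = 0].  The kernel of [h] is an ideal,
    so the action of [A] on [X] must be trivial on the ideal generated by any
    skew subbrace on which it is trivial.  This fails when [A] acts through a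
    homomorphism [rho] from its circle group alone: [ker rho] need not be normal
    in the additive group.  Take for [A] the skew brace of the factorisation
    [S3 = C3 C2], whose additive group is [S3] and whose circle group is
    [C3 x C2], acting on [X = C2 x C2] through the projection to [C3] and an
    automorphism of order 3 of [X].  The action is trivial on [C2], which
    generates [A] as an ideal. *)
From Corelib Require Import ssreflect ssrfun.
Require Import Defs.

Set Implicit Arguments.
Unset Strict Implicit.
Unset Printing Implicit Defensive.
#[local] Obligation Tactic := idtac.

Local Open Scope brace_scope.
Local Notation "0" := zero : brace_scope.
Local Notation "x + y" := (add x y) : brace_scope.
Local Notation "- x" := (opp x) : brace_scope.
Local Notation "x - y" := (add x (opp y)) : brace_scope.
Local Notation "x ∘ y" := (circ x y) (at level 40, left associativity) : brace_scope.

Lemma circA (B : SkewBrace) (a b c : B) : a ∘ (b ∘ c) = a ∘ b ∘ c.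
Proof. exact: (group_assoc (circ_group B)). Qed.

Lemma circ0 (B : SkewBrace) (a : B) : 0 ∘ a = a.
Proof. by rewrite zero_one (group_idl (circ_group B)). Qed.

Lemma circr0 (B : SkewBrace) (a : B) : a ∘ 0 = a.
Proof. by rewrite zero_one (group_idr (circ_group B)). Qed.

Definition hom0 (A B : SkewBrace) : Hom A B :=
  {| hom_fun := fun _ => 0;
     hom_add := fun _ _ => esym (add0 0);
     hom_circ := fun _ _ => esym (circ00 B) |}.

(** * Comparison with the pullback along the zero morphism *)

Section TrivialPullback.
Variables (K A X : SkewBrace) (f : Hom K A) (E : SplitExt A X).
Let s k := ext_s E (f k).
Let mu := ext_mu E.

(** The pullback along zero consists of the pairs [(k, mu x)]. The three conditions make
    [mu x + s k] a morphism from it to [ext E] over [f], and [pullback_univ] factors this morphism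
    through the pullback along [f]. *)
Lemma pullback_trivial :
  (forall x k, s k + mu x = mu x + s k) ->
  (forall x k, s k ∘ mu x = mu x + s k) ->
  (forall x k, mu x ∘ s k = mu x + s k) ->
  split_iso (pullback (hom0 K A) E) (pullback f E).
Proof.
move=> sD sC muC.
pose h (w : pb (hom0 K A) E) : ext E := snd (sval w) + s (fst (sval w)).
have wP (w : pb (hom0 K A) E) : exists x, mu x = snd (sval w).
  by apply/ext_mu_ker; rewrite -(svalP w).
have sadd k l : s (k + l) = s k + s l by rewrite /s !hom_add.
have scirc k l : s (k ∘ l) = s k ∘ s l by rewrite /s !hom_circ.
have hD u v : h (u + v) = h u + h v.
  have [[x ux] [y vy]] := (wP u, wP v).
  rewrite /h /= -ux -vy sadd !addA.
  by rewrite -(addA _ (s (fst (sval u))) (mu y)) sD !addA.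
have hC u v : h (u ∘ v) = h u ∘ h v.
  have [[x ux] [y vy]] := (wP u, wP v).
  (* [muC] turns every sum into a circle product, so that only [s k] and [mu y] remain to be
     interchanged. *)
  rewrite /h /= -ux -vy scirc -!muC -hom_circ -scirc -muC hom_circ scirc !circA.
  by rewrite -(circA _ (s (fst (sval u))) (mu y)) sC -muC !circA.
apply: (@pullback_univ _ _ _ f E (pullback (hom0 K A) E)
  {| hom_fun := h; hom_add := hD; hom_circ := hC |}) => [x | e | k].
- by rewrite /h /s /= !hom_zero addr0.
- by rewrite /h /s /= hom_add ext_ps -(svalP e) add0.
- by rewrite /h /s /= hom_zero add0.
Qed.

(** In the pullback along zero, [(k, 0)] and [(0, mu x)] have the same sum and circle product,
    namely [(k, mu x)]. The isomorphism followed by [pb_g] carries this equality to [ext E]. *)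
Lemma pullback_trivial_circ :
  split_iso (pullback (hom0 K A) E) (pullback f E) ->
  forall x k, s k ∘ mu x = s k + mu x.
Proof.
move=> [h [hmu [_ hs]]] x k.
have sE : s k = pb_g f E (h (pb_s (hom0 K A) E k)) by rewrite hs.
have muE : mu x = pb_g f E (h (pb_mu (hom0 K A) E x)) by rewrite hmu.
rewrite sE muE -!hom_circ -!hom_add; do 2 f_equal.
by apply: pb_eq; rewrite /= ?addr0 ?circr0 // hom_zero add0 circ0.
Qed.
End TrivialPullback.

(** * Split extensions from actions of a circle group *)

Section TrivialBrace.
Variables (T : Type) (op : T -> T -> T) (e : T) (i : T -> T).
Hypothesis opG : is_group op e i.

Lemma trivial_compat a b c : op a (op b c) = op (op (op a b) (i a)) (op a c).
Proof.
rewrite (group_assoc opG _ a c) -(group_assoc opG _ (i a) a).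
by rewrite (group_invl opG) (group_idr opG) (group_assoc opG).
Qed.

Definition trivial_brace : SkewBrace :=
  {| add_group := opG; circ_group := opG; brace_compat := trivial_compat |}.

Variables (A : SkewBrace) (rho : A -> T -> T).
Hypothesis rhoD : forall a x y, rho a (op x y) = op (rho a x) (rho a y).
Hypothesis rho1 : forall x, rho one x = x.
Hypothesis rhoM : forall a b x, rho (a ∘ b) x = rho a (rho b x).

Lemma rho_e a : rho a e = e.
Proof.
rewrite -[LHS](group_idl opG) -{1}(group_invl opG (rho a e)).
by rewrite -(group_assoc opG) -rhoD (group_idl opG) (group_invl opG).
Qed.

(** The addition is that of the direct product; [act_circ] is the semidirect product by [rho]. *)
Definition act_add (u v : T * A) : T * A := (op u.1 v.1, u.2 + v.2).
Definition act_opp (u : T * A) : T * A := (i u.1, - u.2).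
Definition act_circ (u v : T * A) : T * A := (op u.1 (rho u.2 v.1), u.2 ∘ v.2).
Definition act_inv (u : T * A) : T * A := (rho (inv u.2) (i u.1), inv u.2).

Lemma act_add_group : is_group act_add (e, 0) act_opp.
Proof.
have gA := add_group A.
split; rewrite /act_add /act_opp.
- by move=> x y z /=; rewrite (group_assoc opG) (group_assoc gA).
- by move=> [x a] /=; rewrite (group_idl opG) (group_idl gA).
- by move=> [x a] /=; rewrite (group_idr opG) (group_idr gA).
- by move=> [x a] /=; rewrite (group_invl opG) (group_invl gA).
- by move=> [x a] /=; rewrite (group_invr opG) (group_invr gA).
Qed.

Lemma act_circ_group : is_group act_circ (e, one) act_inv.
Proof.
have gA := circ_group A.
split; rewrite /act_circ /act_inv.
- by move=> x y z /=; rewrite rhoD rhoM (group_assoc opG) (group_assoc gA).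
- by move=> [x a] /=; rewrite rho1 (group_idl opG) (group_idl gA).
- by move=> [x a] /=; rewrite rho_e (group_idr opG) (group_idr gA).
- move=> [x a] /=.
  by rewrite -rhoD (group_invl opG) rho_e (group_invl gA).
- move=> [x a] /=.
  by rewrite -rhoM (group_invr gA) rho1 (group_invr opG).
Qed.

(** Both sides use [rho] at [u.2] only, so after [rhoD] the first components satisfy the brace law
    of [trivial_brace]. *)
Lemma act_compat u v w :
  act_circ u (act_add v w) =
  act_add (act_add (act_circ u v) (act_opp u)) (act_circ u w).
Proof.
rewrite /act_circ /act_add /act_opp /= brace_compat rhoD; f_equal.
exact: trivial_compat.
Qed.

Definition act_brace : SkewBrace :=
  {| add_group := act_add_group;
     circ_group := act_circ_group;
     brace_compat := act_compat |}.

Definition act_p : Hom act_brace A :=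
  {| hom_fun := fun u : act_brace => u.2;
     hom_add := fun _ _ => erefl;
     hom_circ := fun _ _ => erefl |}.

Program Definition act_s : Hom A act_brace := {| hom_fun := fun a => (e, a) |}.
Next Obligation. by move=> a b /=; rewrite /act_add /= (group_idl opG). Qed.
Next Obligation. by move=> a b /=; rewrite /act_circ /= rho_e (group_idl opG). Qed.

Program Definition act_mu : Hom trivial_brace act_brace :=
  {| hom_fun := fun x => (x, 0) |}.
Next Obligation. by move=> x y /=; rewrite /act_add /= add0. Qed.
Next Obligation. by move=> x y /=; rewrite /act_circ /= circ00 zero_one rho1. Qed.

Program Definition act_ext : SplitExt A trivial_brace :=
  {| ext := act_brace; ext_p := act_p; ext_s := act_s; ext_mu := act_mu |}.
Next Obligation. by move=> x y []. Qed.
Next Obligation.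
move=> [x a] /=; split=> [-> | [y /(f_equal snd)] //].
by exists x.
Qed.
Next Obligation. by []. Qed.

(** If [rho (f k)] is the identity, all sums and circle products of [(x, 0)] and [(e, f k)] equal
    [(x, f k)]. Conversely, the first components of the circle product and sum of [(e, f k)] and
    [(x, 0)] are [rho (f k) x] and [x]. *)
Lemma pullback_act_trivial (K : SkewBrace) (f : Hom K A) :
  (forall k x, rho (f k) x = x) <->
  split_iso (pullback (hom0 K A) act_ext) (pullback f act_ext).
Proof.
split=> [rhof | /pullback_trivial_circ h k x].
- apply: pullback_trivial => x k /=; rewrite /act_add /act_circ /=.
  + by rewrite (group_idl opG) (group_idr opG) add0 addr0.
  + by rewrite rhof (group_idl opG) (group_idr opG) add0 circr0.
  + by rewrite zero_one rho1 -zero_one circ0 add0.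
- have := f_equal fst (h x k).
  by rewrite /= !(group_idl opG).
Qed.
End TrivialBrace.

(** * The skew brace on S3 and its action on C2 x C2 *)

Inductive C3 := c0 | c1 | c2.

Definition c3_opp (x : C3) :=
  match x with c0 => c0 | c1 => c2 | c2 => c1 end.
Definition c3_add (x y : C3) :=
  match x, y with
  | c0, z | z, c0 => z
  | c1, c1 => c2
  | c2, c2 => c1
  | _, _ => c0
  end.

Definition s3_add (u v : C3 * bool) : C3 * bool :=
  (c3_add u.1 (if u.2 then c3_opp v.1 else v.1), xorb u.2 v.2).
Definition s3_opp (u : C3 * bool) : C3 * bool :=
  (if u.2 then u.1 else c3_opp u.1, u.2).
Definition s3_circ (u v : C3 * bool) : C3 * bool :=
  (c3_add u.1 v.1, xorb u.2 v.2).
Definition s3_inv (u : C3 * bool) : C3 * bool := (c3_opp u.1, u.2).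

Lemma s3_add_group : is_group s3_add (c0, false) s3_opp.
Proof. by split=> [[[] []] [[] []] [[] []]|[[] []]|[[] []]|[[] []]|[[] []]]. Qed.

Lemma s3_circ_group : is_group s3_circ (c0, false) s3_inv.
Proof. by split=> [[[] []] [[] []] [[] []]|[[] []]|[[] []]|[[] []]|[[] []]]. Qed.

(** Writing [a] as n + t with n in C3 and t in C2, [s3_circ a b] is n + b + t, so both sides equal n
    + b + c + t. *)
Lemma s3_compat a b c :
  s3_circ a (s3_add b c) = s3_add (s3_add (s3_circ a b) (s3_opp a)) (s3_circ a c).
Proof. by case: a b c => [[] []] [[] []] [[] []]. Qed.

Definition s3_brace : SkewBrace :=
  {| add_group := s3_add_group;
     circ_group := s3_circ_group;
     brace_compat := s3_compat |}.

Lemma c2_group : is_group xorb false id.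
Proof. by split=> [[] [] []|[]|[]|[]|[]]. Qed.

Definition c2_brace : SkewBrace := trivial_brace c2_group.

Program Definition c2_s3 : Hom c2_brace s3_brace :=
  {| hom_fun := fun b => (c0, b) : s3_brace |}.
Next Obligation. by case. Qed.
Next Obligation. by []. Qed.

Definition v4_add (x y : bool * bool) := (xorb x.1 y.1, xorb x.2 y.2).

Lemma v4_group : is_group v4_add (false, false) id.
Proof. by split=> [[[] []] [[] []] [[] []]|[[] []]|[[] []]|[[] []]|[[] []]]. Qed.

(** This permutes the three nonzero elements cyclically, hence has order 3. *)
Definition v4_rot (x : bool * bool) := (x.2, xorb x.1 x.2).

Definition v4_act (u : s3_brace) (x : bool * bool) :=
  match u.1 with c0 => x | c1 => v4_rot x | c2 => v4_rot (v4_rot x) end.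

Lemma v4_actD u x y : v4_act u (v4_add x y) = v4_add (v4_act u x) (v4_act u y).
Proof. by case: u x y => [[] b] [[] []] [[] []]. Qed.

Lemma v4_act1 x : v4_act one x = x.
Proof. by []. Qed.

Lemma v4_actM (u v : s3_brace) x : v4_act (u ∘ v) x = v4_act u (v4_act v x).
Proof. by case: u v x => [[] b] [[] c] [[] []]. Qed.

(** The additive conjugates of [c2_s3 true] are all the reflections of S3, and these generate it
    additively. *)
Lemma s3_hom_eq0 (T : SkewBrace) (h : Hom s3_brace T) :
  (forall b, h (c2_s3 b) = 0) -> forall u, h u = 0.
Proof.
move=> h0.
(* [n = - n + t - (- n)] in [S3], because [- 2 n = n] in [C3] *)
have ht n : h ((n, true) : s3_brace) = 0.
  pose m : s3_brace := (c3_opp n, false).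
  have -> : (n, true) = m + c2_s3 true - m by rewrite /m; case: n {m}.
  by rewrite !hom_add h0 addr0 hom_opp addrN.
case=> n [] //.
have -> : (n, false) = add ((n, true) : s3_brace) (c2_s3 true) by case: n.
by rewrite hom_add ht h0 addr0.
Qed.

Theorem mainTheorem2 :
  ~ (forall X : SkewBrace, exists T : SkewBrace,
       nat_isomorphic (Split X) (Representable T)).
Proof.
move=> /(_ (trivial_brace v4_group)) [T [eta [eta_nat eta_bij]]].
pose E := act_ext v4_group v4_actD v4_act1 v4_actM.
pose h : Hom s3_brace T := eta s3_brace (class_of E).
have etaE K (f : Hom K s3_brace) :
    eta K (class_of (pullback f E)) = hom_comp h f.
  by rewrite -split_map_class; exact: eta_nat.
(* The injective map [eta K] sends the two pullback classes to [h] composed with zero and with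
   [f]. *)
have trivial_iff K (f : Hom K s3_brace) :
    (forall k x, v4_act (f k) x = x) <-> (forall k, h (f k) = 0).
{ apply: (iff_trans (pullback_act_trivial v4_group v4_actD v4_act1 v4_actM f)).
  apply: (iff_trans (iff_sym (class_ofP _ _))); split=> [eq_cl k | hf].
  - have /(f_equal (fun g : Hom K T => g k)) := f_equal (eta K) eq_cl.
    by rewrite !etaE /= (hom_zero h).
  - apply: (bij_inj (eta_bij K)); rewrite !etaE; apply: hom_eq => k /=.
    by rewrite hf (hom_zero h). }
have h0 : forall u, h u = 0.
  (* The image of [c2_s3] has first component [c0], which acts as the identity by computation. *)
  by apply: s3_hom_eq0; apply/trivial_iff.
(* Now all of [s3_brace] would act trivially, yet [c1] sends [(true, false)] to [(false, true)]. *)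
by have /(_ (c1, false) (true, false)) := (trivial_iff _ (hom_id s3_brace)).2 h0.
Qed.
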